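(* Let $A$ and $B$ be finite join-semidistributive lattices. Then the box product $A\mathbin{\square}B$ of $A$ and $B$ is join-semidistributive, and $$\mathrm{Dim}(A\mathbin{\square}B)\cong\mathrm{Dim}\,A\otimes\mathrm{Dim}\,B.$$
   Context: A lattice $L$ is join-semidistributive if $x\vee y=x\vee z$ implies $x\vee y=x\vee(y\wedge z)$ for all $x,y,z\in L$. The dimension monoid $\mathrm{Dim}\,L$ of a lattice $L$ is the commutative monoid (with zero element $0$) defined by generators $\Delta(x,y)$, for $x\le y$ in $L$, and relations: $\Delta(x,x)=0$; $\Delta(x,z)=\Delta(x,y)+\Delta(y,z)$ for $x\le y\le z$; $\Delta(x\wedge y,x)=\Delta(y,x\vee y)$, for all $x,y,z\in L$. For commutative monoids $M,N$, $M\otimes N$ denotes the tensor product of commutative monoids: the commutative monoid generated by elements $\alpha\otimes\beta$ ($\alpha\in M$, $\beta\in N$), universal subject to $(\alpha,\beta)\mapsto\alpha\otimes\beta$ being additive in each variable and $\alpha\otimes0=0=0\otimes\beta$. For lattices $A$ and $B$ with zero, let $\bot_{A,B}=(A\times\{0_B\})\cup(\{0_A\}\times B)$ and, for $(a,b)\in A\times B$, $a\otimes b=\bot_{A,B}\cup\{(x,y)\in A\times B\mid x\le a\text{ and }y\le b\}$. A mixed tensor is a subset of $A\times B$ of the form $(a\otimes b')\cup(a'\otimes b)$ with $a\le a'$ in $A$ and $b\le b'$ in $B$. For bounded lattices $A$ and $B$, the box product $A\mathbin{\square}B$ is the set of all finite intersections of mixed tensors, ordered by inclusion; it is a lattice.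 *)

(* Defs.v *)
From HB Require Import structures.
From mathcomp Require Import all_boot all_order all_algebra.
From mathcomp Require Import boolp.

Set Implicit Arguments.
Unset Strict Implicit.
Unset Printing Implicit Defensive.

Import Order.TTheory GRing.Theory.

Local Open Scope order_scope.
Local Open Scope quotient_scope.

Definition join_semidistributive (d : Order.disp_t) (L : latticeType d) : Prop :=
  forall x y z : L, x `|` y = x `|` z -> x `|` y = x `|` (y `&` z).

Section Presentation.
Variables (G : choiceType) (R : seq G -> seq G -> Prop).

(* The least congruence of the free monoid seq G that contains R and makes
   concatenation commutative. *)
Inductive cm_cong : seq G -> seq G -> Prop :=
| cm_cong_rel s t : R s t -> cm_cong s t
| cm_cong_comm s t : cm_cong (s ++ t) (t ++ s)
| cm_cong_cat s s' t t' :
    cm_cong s s' -> cm_cong t t' -> cm_cong (s ++ t) (s' ++ t')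
| cm_cong_refl s : cm_cong s s
| cm_cong_sym s t : cm_cong s t -> cm_cong t s
| cm_cong_trans s t u : cm_cong s t -> cm_cong t u -> cm_cong s u.

Definition cm_congb (s t : seq G) : bool := `[< cm_cong s t >].

Lemma cm_congb_refl : reflexive cm_congb.
Proof. by move=> s; apply/asboolP/cm_cong_refl. Qed.

Lemma cm_congb_sym : symmetric cm_congb.
Proof. by move=> s t; apply/asboolP/asboolP; apply: cm_cong_sym. Qed.

Lemma cm_congb_trans : transitive cm_congb.
Proof.
by move=> t s u /asboolP st /asboolP tu; apply/asboolP/(cm_cong_trans st tu).
Qed.

Canonical cm_congb_equiv :=
  EquivRel cm_congb cm_congb_refl cm_congb_sym cm_congb_trans.

(* The commutative monoid presented by generators G and relations R; a word
   s : seq G stands for the sum of its letters. *)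
Definition cmon : Type := {eq_quot cm_congb}.

HB.instance Definition _ := Choice.on cmon.
HB.instance Definition _ : EqQuotient (seq G) cm_congb cmon := EqQuotient.on cmon.

Definition cm_class (s : seq G) : cmon := \pi_cmon s.

Lemma cm_classP s t : cm_class s = cm_class t <-> cm_cong s t.
Proof. by split=> [/eqmodP/asboolP|st] //; apply/eqmodP/asboolP. Qed.

Definition cm_gen (g : G) : cmon := cm_class [:: g].

Definition cm_zero : cmon := cm_class [::].
Definition cm_add (u v : cmon) : cmon := cm_class (repr u ++ repr v).

Lemma cm_class_cat s t : cm_add (cm_class s) (cm_class t) = cm_class (s ++ t).
Proof. by apply/cm_classP; apply: cm_cong_cat; apply/cm_classP; exact: reprK. Qed.

Lemma cm_classK (u : cmon) : exists s, u = cm_class s.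
Proof. by exists (repr u); rewrite /cm_class reprK. Qed.

Lemma cm_addA : associative cm_add.
Proof.
move=> u v w; have [s ->] := cm_classK u; have [t ->] := cm_classK v.
by have [r ->] := cm_classK w; rewrite !cm_class_cat catA.
Qed.

Lemma cm_addC : commutative cm_add.
Proof.
move=> u v; have [s ->] := cm_classK u; have [t ->] := cm_classK v.
by rewrite !cm_class_cat; apply/cm_classP; exact: cm_cong_comm.
Qed.

Lemma cm_add0 : left_id cm_zero cm_add.
Proof. by move=> u; have [s ->] := cm_classK u; rewrite cm_class_cat. Qed.

HB.instance Definition _ := GRing.isNmodule.Build cmon cm_addA cm_addC cm_add0.

End Presentation.

Section DimensionMonoid.
Variables (d : Order.disp_t) (L : latticeType d).

Definition interval := {p : L * L | p.1 <= p.2}.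

Definition itv (x y : L) (xy : x <= y) : interval := exist _ (x, y) xy.

Inductive dim_rel : seq interval -> seq interval -> Prop :=
| dim_rel0 (x : L) : dim_rel [:: itv (lexx x)] [::]
| dim_relD (x y z : L) (xy : x <= y) (yz : y <= z) :
    dim_rel [:: itv (le_trans xy yz)] [:: itv xy; itv yz]
| dim_relIU (x y : L) : dim_rel [:: itv (leIl x y)] [:: itv (leUr y x)].

Definition Dim := cmon dim_rel.
HB.instance Definition _ := GRing.Nmodule.on Dim.

Definition Delta (x y : L) (xy : x <= y) : Dim := cm_gen dim_rel (itv xy).

End DimensionMonoid.

Section TensorProduct.
Variables M N : nmodType.

Inductive tensor_rel : seq (M * N) -> seq (M * N) -> Prop :=
| tensor_relDl a a' b : tensor_rel [:: ((a + a')%R, b)] [:: (a, b); (a', b)]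
| tensor_relDr a b b' : tensor_rel [:: (a, (b + b')%R)] [:: (a, b); (a, b')]
| tensor_rel0l b : tensor_rel [:: (0%R, b)] [::]
| tensor_rel0r a : tensor_rel [:: (a, 0%R)] [::].

Definition tensor := cmon tensor_rel.
HB.instance Definition _ := GRing.Nmodule.on tensor.

Definition tens (a : M) (b : N) : tensor := cm_gen tensor_rel (a, b).

End TensorProduct.

Section BoxProduct.
Variables (dA dB : Order.disp_t).
Variables (A : finTBLatticeType dA) (B : finTBLatticeType dB).
Implicit Types X Y Z : {set A * B}.

Definition bot_tensor : {set A * B} :=
  [set p | (p.2 == \bot) || (p.1 == \bot)].

Definition pure_tensor (a : A) (b : B) : {set A * B} :=
  bot_tensor :|: [set p | (p.1 <= a) && (p.2 <= b)].

Definition mixed_tensor X : bool :=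
  [exists a : A, exists a' : A, exists b : B, exists b' : B,
    [&& a <= a', b <= b' & X == pure_tensor a b' :|: pure_tensor a' b]].

(* Since A * B is finite, every set of mixed tensors is finite.  The empty
   intersection A * B is itself the mixed tensor with a = a' = \top and
   b = b' = \top. *)
Definition in_box X : bool :=
  [exists S : {set {set A * B}},
    [forall X0 in S, mixed_tensor X0] && (X == \bigcap_(X0 in S) X0)].

Record box := Box { box_val :> {set A * B}; box_valP : in_box box_val }.

HB.instance Definition _ := [isSub for box_val].
HB.instance Definition _ := [Finite of box by <:].

Lemma in_boxP X :
  reflect (exists2 S : {set {set A * B}},
             {in S, forall X0, mixed_tensor X0} & X = \bigcap_(X0 in S) X0)
          (in_box X).
Proof.
apply: (iffP existsP) => [[S /andP[/forall_inP mS /eqP->]]|[S mS ->]].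
  by exists S.
by exists S; rewrite eqxx andbT; apply/forall_inP.
Qed.

Lemma in_box_bigcap (P : pred {set A * B}) :
  (forall X, P X -> in_box X) -> in_box (\bigcap_(X | P X) X).
Proof.
move=> boxP; apply/in_boxP.
exists [set X0 | mixed_tensor X0 && (\bigcap_(X | P X) X \subset X0)].
  by move=> X0; rewrite inE => /andP[].
apply/eqP; rewrite eqEsubset; apply/andP; split.
  by apply/bigcapsP => X0; rewrite inE => /andP[].
apply/bigcapsP => X PX; have /in_boxP[S mS defX] := boxP X PX.
rewrite defX; apply/bigcapsP => X0 SX0.
apply: bigcap_inf; rewrite inE mS //=.
by apply: (subset_trans (bigcap_inf _ PX)); rewrite defX bigcap_inf.
Qed.

Lemma in_boxI X Y : in_box X -> in_box Y -> in_box (X :&: Y).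
Proof.
move=> bX bY; have -> : X :&: Y = \bigcap_(Z | (Z == X) || (Z == Y)) Z.
  apply/eqP; rewrite eqEsubset; apply/andP; split.
    apply/bigcapsP => Z /orP[/eqP->|/eqP->]; [exact: subsetIl|exact: subsetIr].
  by rewrite subsetI !bigcap_inf ?eqxx ?orbT.
by apply: in_box_bigcap => Z /orP[/eqP->|/eqP->].
Qed.

Definition box_le (X Y : box) : bool := box_val X \subset box_val Y.

Definition box_meet (X Y : box) : box :=
  Box (in_boxI (box_valP X) (box_valP Y)).

Lemma in_box_join X Y :
  in_box (\bigcap_(Z | in_box Z && (X :|: Y \subset Z)) Z).
Proof. by apply: in_box_bigcap => Z /andP[]. Qed.

Definition box_join (X Y : box) : box := Box (in_box_join X Y).

Lemma box_le_refl : reflexive box_le.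
Proof. by move=> X; exact: subxx. Qed.

Lemma box_le_anti : antisymmetric box_le.
Proof. by move=> X Y XY; apply/val_inj/eqP; rewrite eqEsubset. Qed.

Lemma box_le_trans : transitive box_le.
Proof. by move=> Y X Z; exact: subset_trans. Qed.

Lemma box_leI (X Y Z : box) :
  box_le X (box_meet Y Z) = box_le X Y && box_le X Z.
Proof. exact: subsetI. Qed.

Lemma box_leU (X Y Z : box) :
  box_le (box_join X Y) Z = box_le X Z && box_le Y Z.
Proof.
rewrite /box_le /= -subUset; apply/idP/idP => [|XYZ].
  by apply: subset_trans; apply/bigcapsP => W /andP[].
by apply: bigcap_inf; rewrite box_valP.
Qed.

End BoxProduct.

Fact box_display (dA dB : Order.disp_t) : Order.disp_t.
Proof. exact: Order.Disp tt tt. Qed.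

Section BoxLattice.
Variables (dA dB : Order.disp_t).
Variables (A : finTBLatticeType dA) (B : finTBLatticeType dB).

HB.instance Definition _ := Order.Le_isPOrder.Build (box_display dA dB)
  (box A B) (@box_le_refl _ _ A B) (@box_le_anti _ _ A B) (@box_le_trans _ _ A B).
HB.instance Definition _ := Order.POrder_MeetJoin_isLattice.Build
  (box_display dA dB) (box A B) (@box_leI _ _ A B) (@box_leU _ _ A B).

End BoxLattice.

(* Main.v *)
(* Write D(r) = Delta(r_*, r) for r join-irreducible. In a finite join-semidistributive
   lattice, Delta(x, y) is the sum of D(r) over all join-irreducible r <= y with
   r not <= x. Indeed Delta(x, y) is a sum of one D(p) per step of a chain, and the
   other r that appear in the same step are absorbed: if p_* <= w, p is not <= w,
   r <= w \/ p, r is not <= w and r <> p, then D(r) + D(p) = D(p).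

   The elements of A [] B are the intersections of the sets
   cobox a b = {(x, y) | x <= a or y <= b}. Mutually inverse maps are given by
     f : Delta(X, Y) |-> sum of D(p) (x) D(q) over (p, q) in Y \ X,
     g : Delta(a, a') (x) Delta(b, b') |-> Delta((a (x) b') \cup (a' (x) b), a' (x) b').
   That f respects perspectivity follows from absorption in A and B: a pair (s, t) in
   X \/ Y but in neither X nor Y is absorbed by a pair (p, q) in X \ Y, which is seen by
   separating (s, t) from Y with a maximal cobox. The identities f g = 1 and g f = 1
   are the sum formula in A and B, and in A [] B, respectively. *)
Require Import Defs.
From HB Require Import structures.
From mathcomp Require Import all_boot all_order all_algebra.
From mathcomp Require Import boolp.

Set Implicit Arguments.
Unset Strict Implicit.
Unset Printing Implicit Defensive.

Import Order.TTheory GRing.Theory.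

Local Open Scope order_scope.

(** * Universal properties of presented commutative monoids and of their tensor product *)

Section PresentedMonoid.
Variables (G : choiceType) (R : seq G -> seq G -> Prop).

Lemma cm_class_sum s : cm_class R s = (\sum_(g <- s) cm_gen R g)%R.
Proof.
elim: s => [|g s IHs]; first by rewrite big_nil.
by rewrite big_cons -IHs -cat1s -cm_class_cat.
Qed.

Lemma cm_ind (P : cmon R -> Prop) :
  P 0%R -> (forall u v, P u -> P v -> P (u + v)%R) ->
  (forall g, P (cm_gen R g)) -> forall u, P u.
Proof.
move=> P0 PD Pg u; have [s ->] := cm_classK u; rewrite cm_class_sum.
by elim/big_ind: _.
Qed.

Lemma cm_cong_sum (M : nmodType) (h : G -> M) :
  (forall s t, R s t -> \sum_(g <- s) h g = \sum_(g <- t) h g)%R ->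
  forall s t, cm_cong R s t -> (\sum_(g <- s) h g = \sum_(g <- t) h g)%R.
Proof.
move=> hR s t; elim=> {s t} [s t|s t|s s' t t' _ IHs _ IHt|//|s t _ //|].
- exact: hR.
- by rewrite !big_cat /= addrC.
- by rewrite !big_cat /= IHs IHt.
- by move=> s t u _ -> _ ->.
Qed.

(** The additive map sums [h] over a chosen representative word; by [cm_cong_sum] the choice does
    not matter. *)
Lemma cm_lift (M : nmodType) (h : G -> M) :
  (forall s t, R s t -> \sum_(g <- s) h g = \sum_(g <- t) h g)%R ->
  exists f : {additive cmon R -> M}, forall g, f (cm_gen R g) = h g.
Proof.
move=> hR; pose f (u : cmon R) := (\sum_(g <- repr u) h g)%R.
have fE s : f (cm_class R s) = (\sum_(g <- s) h g)%R.
  by apply: (cm_cong_sum hR); apply/cm_classP; exact: reprK.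
have f0 : f 0%R = 0%R by rewrite (fE [::]) big_nil.
have fD : {morph f : u v / (u + v)%R >-> (u + v)%R}.
  move=> u v; have [s ->] := cm_classK u; have [t ->] := cm_classK v.
  by rewrite [(_ + _)%R]cm_class_cat !fE big_cat.
pose fM := GRing.isNmodMorphism.Build _ _ f (conj f0 fD).
pose F : {additive cmon R -> M} := HB.pack f fM.
by exists F => g; rewrite [LHS]fE big_seq1.
Qed.

End PresentedMonoid.

(** The double sum of [c] over representative words is independent of the words, one variable at a
    time, after exchanging the two sums. *)
Lemma cm_bilift (G H : choiceType) (R : seq G -> seq G -> Prop)
    (S : seq H -> seq H -> Prop) (M : nmodType) (c : G -> H -> M) :
  (forall s t h, R s t -> \sum_(g <- s) c g h = \sum_(g <- t) c g h)%R ->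
  (forall s t g, S s t -> \sum_(h <- s) c g h = \sum_(h <- t) c g h)%R ->
  exists f : {additive tensor (cmon R) (cmon S) -> M},
    forall g h, f (tens (cm_gen R g) (cm_gen S h)) = c g h.
Proof.
move=> cR cS.
pose f (u : cmon R) (v : cmon S) := (\sum_(g <- repr u) \sum_(h <- repr v) c g h)%R.
have fE s t : f (cm_class R s) (cm_class S t) = (\sum_(g <- s) \sum_(h <- t) c g h)%R.
  rewrite /f (eq_bigr (fun g => \sum_(h <- t) c g h)%R) => [|g _]; last first.
    apply: cm_cong_sum => [s' t'|]; first exact: cS.
    by apply/cm_classP; exact: reprK.
  rewrite exchange_big [RHS]exchange_big; apply: eq_bigr => h _.
  apply: (cm_cong_sum (R := R)) => [s' t'|]; first exact: cR.
  by apply/cm_classP; exact: reprK.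
have [|F FE] := @cm_lift _ (@tensor_rel (cmon R) (cmon S)) M (fun p => f p.1 p.2).
  move=> s t [u u' v|u v v'|v|u]; rewrite ?big_cons ?big_nil /= ?addr0.
  - have [{}s ->] := cm_classK u; have [s' ->] := cm_classK u'.
    have [{}t ->] := cm_classK v.
    by rewrite [(cm_class R s + _)%R]cm_class_cat !fE big_cat.
  - have [{}s ->] := cm_classK u; have [{}t ->] := cm_classK v.
    have [t' ->] := cm_classK v'.
    rewrite [(cm_class S t + _)%R]cm_class_cat !fE -big_split /=.
    by apply: eq_bigr => g _; rewrite big_cat.
  - by have [{}t ->] := cm_classK v; rewrite (fE [::]) big_nil.
  - have [{}s ->] := cm_classK u; rewrite (fE _ [::]) big1 // => g _.
    exact: big_nil.
by exists F => g h; rewrite FE /= fE !big_seq1.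
Qed.

Section Tensor.
Variables M N : nmodType.
Implicit Types (a : M) (b : N).

Lemma tensDl a a' b : (tens (a + a') b = tens a b + tens a' b)%R.
Proof.
rewrite /tens /cm_gen [RHS]cm_class_cat; apply/cm_classP/cm_cong_rel.
exact: tensor_relDl.
Qed.

Lemma tensDr a b b' : (tens a (b + b') = tens a b + tens a b')%R.
Proof.
rewrite /tens /cm_gen [RHS]cm_class_cat; apply/cm_classP/cm_cong_rel.
exact: tensor_relDr.
Qed.

Lemma tens0l b : tens (0 : M)%R b = 0%R.
Proof. by apply/cm_classP/cm_cong_rel; exact: tensor_rel0l. Qed.

Lemma tens0r a : tens a (0 : N)%R = 0%R.
Proof. by apply/cm_classP/cm_cong_rel; exact: tensor_rel0r. Qed.

Lemma tens_sum (I J : finType) (P : pred I) (Q : pred J) (F : I -> M) (G : J -> N) :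
  tens (\sum_(i | P i) F i)%R (\sum_(j | Q j) G j)%R =
  (\sum_(k : I * J | P k.1 && Q k.2) tens (F k.1) (G k.2))%R.
Proof.
rewrite -(pair_big P Q (fun i j => tens (F i) (G j))) /=.
rewrite (big_morph (fun a => tens a _) (fun a a' => tensDl a a' _) (tens0l _)).
apply: eq_bigr => i _.
exact: (big_morph (tens (F i)) (tensDr (F i)) (tens0r (F i))).
Qed.

End Tensor.

(** Each [F i] disappears into a summand [F j] already present in the second sum. *)
Lemma sum_absorb (M : nmodType) (I : finType) (P Q : pred I) (F : I -> M) :
  (forall i, P i -> exists2 j, Q j & F i + F j = F j)%R ->
  (\sum_(i | P i) F i + \sum_(j | Q j) F j = \sum_(j | Q j) F j)%R.
Proof.
move=> absF; elim/big_rec: _ => [|i x Pi IHx]; first exact: add0r.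
have [j Qj Fij] := absF i Pi.
by rewrite -addrA IHx (bigD1 j Qj) /= addrA Fij.
Qed.

(** * Calculus of the dimension map on arbitrary pairs *)

Section Distance.
Variables (d : Order.disp_t) (L : latticeType d).
Implicit Types x y z : L.

(* Extends [Delta x y] to all pairs, by relativizing to [x `&` y <= y]. *)
Definition delta x y : Dim L := Delta (leIr y x).

Lemma DeltaE x y (xy : x <= y) : Delta xy = delta x y.
Proof.
rewrite /delta /Delta; congr cm_gen; apply: val_inj => /=.
by rewrite (meet_idPl xy).
Qed.

Lemma eq_deltaI x x' y : x `&` y = x' `&` y -> delta x y = delta x' y.
Proof.
move=> xx'; rewrite /delta /Delta; congr cm_gen; apply: val_inj => /=.
by rewrite xx'.
Qed.

Lemma delta_le0 x y : y <= x -> delta x y = 0%R.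
Proof.
move=> yx; rewrite (@eq_deltaI x y) ?(meet_idPr yx) ?meetxx//.
by rewrite -(DeltaE (lexx y)); apply/cm_classP/cm_cong_rel; exact: dim_rel0.
Qed.

Lemma delta_trans x y z : x <= y -> y <= z ->
  delta x z = (delta x y + delta y z)%R.
Proof.
move=> xy yz; rewrite -(DeltaE (le_trans xy yz)) -(DeltaE xy) -(DeltaE yz).
rewrite [RHS]cm_class_cat; apply/cm_classP/cm_cong_rel.
exact: dim_relD.
Qed.

(** The perspectivity relation of [Dim L], in relativized form. *)
Lemma deltaU x y : delta x (x `|` y) = delta x y.
Proof.
rewrite (@eq_deltaI x (y `&` x) y); last by rewrite [y `&` x]meetC -meetA meetxx.
rewrite -(DeltaE (leIl y x)) joinC -(DeltaE (leUr x y)).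
by apply/cm_classP/cm_cong_sym/cm_cong_rel; exact: dim_relIU.
Qed.

Lemma deltaD x y z : y <= z -> delta x z = (delta x y + delta (x `|` y) z)%R.
Proof.
move=> yz; rewrite -deltaU (@delta_trans _ (x `|` y)) ?leUl ?leU2 //.
by rewrite deltaU -[delta (x `|` y) z]deltaU -joinA (join_idPr yz).
Qed.

End Distance.

(** * Absorption and the sum formula over join-irreducible elements *)

(* [e] enumerates the join-irreducible elements and [l] their lower covers, possibly
   together with degenerate indices where [l i = e i]. For [A] this allows [e] to be
   the identity, and for [box A B] all pure tensors, including those equal to [\bot]. *)
Section JoinIrreducibles.
Variables (d : Order.disp_t) (L : latticeType d) (I : finType) (e l : I -> L).
Implicit Types (x y u v w : L) (i j p s : I).

Hypothesis le_le : forall i, l i <= e i.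
Hypothesis lt_le : forall i x, x < e i -> x <= l i.
Hypothesis dense : forall u v, ~~ (v <= u) ->
  exists i, [/\ e i <= v, ~~ (e i <= u) & l i <= u].
(** Values of [e] may repeat only at degenerate indices, where [D i] is zero. *)
Hypothesis e_inj : forall i j, e i = e j -> i = j \/ l i = e i.

Let D i : Dim L := delta (l i) (e i).
Let above u v := [set i | e i <= v & ~~ (e i <= u)].

Lemma meet_le_lower u i : ~~ (e i <= u) -> u `&` e i <= l i.
Proof. move=> eiu; apply: lt_le; rewrite lt_neqAle leIr andbT.
by apply: contraNneq eiu => <-; exact: leIl. Qed.

Lemma delta_step u i : ~~ (e i <= u) -> l i <= u -> delta u (e i) = D i.
Proof.
move=> eiu liu; apply: eq_deltaI; rewrite (meet_idPl (le_le i)).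
by apply/le_anti; rewrite meet_le_lower // lexI liu le_le.
Qed.

Lemma delta_split u i : ~~ (e i <= u) ->
  delta u (e i) = (delta u (l i) + D i)%R.
Proof.
move=> eiu; rewrite (@eq_deltaI _ _ u (u `&` e i)); last by rewrite -meetA meetxx.
rewrite (@delta_trans _ _ _ (l i)) ?meet_le_lower //; congr (_ + _)%R.
by apply: eq_deltaI; rewrite -meetA (meet_idPr (le_le i)).
Qed.

(** Decreasing measure for the inductions that climb from [u] towards [v]. *)
Lemma card_above_step u v i : e i <= v -> ~~ (e i <= u) ->
  (#|above (u `|` e i) v| < #|above u v|)%N.
Proof.
move=> eiv eiu; apply/proper_card/properP; split; last first.
  by exists i; rewrite !inE ?eiv ?eiu //= leUr.
apply/subsetP => j; rewrite !inE => /andP[-> /=].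
by apply: contra => /le_trans -> //; exact: leUl.
Qed.

(** Joining to [u] an index supplied by [dense] costs exactly one [D i], so [delta u v] is a sum of
    such elements. *)
Lemma delta_ind (P : Dim L -> Prop) u v :
  P 0%R -> (forall a b, P a -> P b -> P (a + b)%R) ->
  (forall i, e i <= v -> ~~ (e i <= u) -> P (D i)) -> P (delta u v).
Proof.
move=> P0 PD; have [n] := ubnP #|above u v|.
elim: n u => // n IHn u ltn PDi.
have [vu|/dense [i [eiv eiu liu]]] := boolP (v <= u); first by rewrite delta_le0.
rewrite (deltaD _ eiv) delta_step //; apply: PD; first exact: PDi.
apply: IHn => [|j ejv eju].
  by apply: leq_trans (card_above_step eiv eiu) _; rewrite -ltnS.
by apply: PDi => //; apply: contra eju => /le_trans -> //; exact: leUl.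
Qed.

Hypothesis jsd : join_semidistributive L.

(** Strong induction on the number of indices below [e s]. If [e p] lies below the join of [w] and
    [e s], then [e p <= l s], so [delta w (l s)] and [delta w (e s)] both equal [D p], and they
    differ by [D s]. Otherwise the induction hypothesis absorbs [delta w (l s)] into [D p], and
    splitting [delta w (e p)] at that join exhibits [D s] as a summand. *)
Lemma dependency_absorb w p s : l p <= w -> ~~ (e p <= w) ->
  s != p -> e s <= w `|` e p -> ~~ (e s <= w) -> (D s + D p = D p)%R.
Proof.
move=> lpw epw; have [n] := ubnP #|[set i | e i <= e s]|.
elim: n s => // n IHn s lts sp esy esw.
have [ls|ls] := eqVneq (l s) (e s); first by rewrite /D ls delta_le0 ?add0r.
have lses : l s < e s by rewrite lt_neqAle ls le_le.
have dp : delta w (e p) = D p by exact: delta_step.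
have [epws|epws] := boolP (e p <= w `|` e s).
  have wsp : w `|` e s = w `|` e p.
    by apply/le_anti; rewrite !leUx !leUl esy epws.
  (* If this failed, the meet of [e s] and [e p] would lie below [l p], hence below [w], and
     semidistributivity would put [e p] below [w]. *)
  have eps : e p <= e s.
    apply: contraT => eps; have := jsd wsp; rewrite wsp => wp.
    case/negP: epw; apply: le_trans (leUr _ w) _.
    by rewrite wp leUx lexx (le_trans (meet_le_lower eps)).
  have epls : e p <= l s.
    apply: lt_le; rewrite lt_neqAle eps andbT; apply: contraNneq ls => epes.
    by case: (e_inj (esym epes)) => [/eqP|->] //; rewrite (negPf sp).
  have wls : w `|` l s = w `|` e p.
    apply/le_anti; rewrite !leUx !leUl (le_trans (le_le s) esy) /=.
    exact: le_trans epls (leUr _ _).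
  have := delta_split esw.
  rewrite -(deltaU w (l s)) wls deltaU -(deltaU w (e s)) wsp deltaU dp.
  by rewrite addrC => <-.
have absls : (delta w (l s) + D p = D p)%R.
  pose P a := (a + D p = D p)%R; apply: (@delta_ind P); first exact: add0r.
    by move=> a b Pa Pb; rewrite /P -addrA Pb.
  move=> i eils eiw; apply: IHn => //.
  - rewrite -ltnS; apply: leq_trans lts; rewrite ltnS.
    apply/proper_card/properP; split.
      apply/subsetP => j; rewrite !inE => /le_trans; apply.
      exact: le_trans eils (le_le s).
    exists s; rewrite !inE ?lexx //; apply/negP => /le_lt_trans.
    by move=> /(_ _ (le_lt_trans eils lses)); rewrite ltxx.
  - apply: contraNneq epws => <-; apply: le_trans (leUr _ _).
    exact: le_trans eils (le_le s).
  - by apply: le_trans esy; apply: le_trans (le_le s).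
have : D p = (delta w (e s) + D p)%R.
  rewrite -[LHS]dp -deltaU (@delta_trans _ _ _ (w `|` e s)) ?leUl //; last first.
    by rewrite leUx leUl.
  rewrite deltaU -(@delta_step (w `|` e s) p) //; last exact: le_trans (leUl _ _).
  by congr (_ + _)%R; rewrite -[RHS]deltaU joinAC (join_idPl esy).
rewrite delta_split // => dpE.
by rewrite -{1}absls addrCA addrA -dpE.
Qed.

Lemma delta_sum u v :
  delta u v = (\sum_(i | ((e i <= v) && ~~ (e i <= u))%O) D i)%R.
Proof.
have [n] := ubnP #|above u v|.
elim: n u => // n IHn u ltn.
have [vu|/dense [i [eiv eiu liu]]] := boolP (v <= u).
  rewrite delta_le0 // big1 // => i /andP[/le_trans /(_ vu) ->] //.
rewrite (deltaD _ eiv) delta_step // IHn; last first.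
  by apply: leq_trans (card_above_step eiv eiu) _; rewrite -ltnS.
(* The indices that fall below the join of [u] and [e i] in this step are [i] itself and indices
   absorbed by [D i]. *)
rewrite [RHS](bigID (fun j => e j <= u `|` e i)) /=; congr (_ + _)%R.
  rewrite (bigD1 i) /= ?eiv ?eiu ?leUr //= addrC; symmetry.
  have := @sum_absorb _ _ _ (pred1 i) D; rewrite big_pred1_eq; apply=> j.
  move=> /andP[/andP[/andP[_ eju] ejui] ji]; exists i => //=.
  exact: (@dependency_absorb u).
apply: eq_bigl => j; case: (e j <= v) => //=.
have [ejui|ejui] := boolP (e j <= u `|` e i); first by rewrite andbF.
rewrite andbT; symmetry; apply: contra ejui => /le_trans -> //; exact: leUl.
Qed.

End JoinIrreducibles.

(** * The sum formula in a finite lattice, indexed by all its elements *)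

Section FiniteLattice.
Variables (d : Order.disp_t) (A : finTBLatticeType d).
Implicit Types x y r : A.

(* The unique lower cover of [r] when [r] is join-irreducible, and [r] itself otherwise. *)
Definition low r : A := \join_(x : A | x < r) x.

Lemma low_le r : low r <= r.
Proof. by apply/joinsP => x /ltW. Qed.

Lemma lt_low x r : x < r -> x <= low r.
Proof. by move=> xr; exact: (@joins_sup _ _ _ x [pred y | y < r] id xr). Qed.

Definition height x : nat := #|[set y : A | y <= x]|.

Lemma lt_height x y : x < y -> (height x < height y)%N.
Proof.
move=> xy; apply/proper_card/properP; split.
  by apply/subsetP => z; rewrite !inE => /le_trans -> //; exact: ltW.
by exists y; rewrite !inE ?lexx ?lt_geF.
Qed.

(** Take [r] of least height below [y] and not below [x]: everything strictly below [r] is then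
    below [x]. *)
Lemma low_dense x y : ~~ (y <= x) -> exists r, [/\ r <= y, ~~ (r <= x) & low r <= x].
Proof.
move=> yx; pose P r := (r <= y) && ~~ (r <= x).
have Py : P y by rewrite /P lexx.
case: (arg_minnP height Py) => r /andP[ry rx] rmin; exists r; split=> //.
apply/joinsP => z zr; apply: contraT => zx.
have /rmin : P z by rewrite /P zx (le_trans (ltW zr)).
by rewrite leqNgt lt_height.
Qed.

Hypothesis jsd : join_semidistributive A.

Lemma low_absorb a p s : low p <= a -> ~~ (p <= a) ->
  s != p -> s <= a `|` p -> ~~ (s <= a) ->
  (delta (low s) s + delta (low p) p = delta (low p) p)%R.
Proof.
apply: (@dependency_absorb _ A A id low) => //.
- exact: low_le.
- by move=> i x; exact: lt_low.
- exact: low_dense.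
- by left.
Qed.

Lemma delta_low_sum x y :
  delta x y = (\sum_(r : A | ((r <= y) && ~~ (r <= x))%O) delta (low r) r)%R.
Proof.
apply: (@delta_sum _ A A id low) => //.
- exact: low_le.
- by move=> i z; exact: lt_low.
- exact: low_dense.
- by left.
Qed.

End FiniteLattice.

(** * The box product: coboxes, semidistributivity, and its sum formula *)

Section Box.
Variables (dA dB : Order.disp_t).
Variables (A : finTBLatticeType dA) (B : finTBLatticeType dB).
Implicit Types (X Y Z V W : box A B) (a p s x : A) (b q t y : B).

Lemma box_leE X Y : (X <= Y) = (X \subset Y).
Proof. by []. Qed.

Lemma in_box_mixed (X0 : {set A * B}) : mixed_tensor X0 -> in_box X0.
Proof.
move=> mX; apply/in_boxP; exists [set X0]; last by rewrite big_set1.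
by move=> X1 /set1P ->.
Qed.

(** The mixed tensor with [a' = \top] and [b' = \top]. *)
Definition cobox_set a b : {set A * B} := [set z | (z.1 <= a) || (z.2 <= b)].

Lemma in_box_cobox a b : in_box (cobox_set a b).
Proof.
apply/in_box_mixed/existsP; exists a; apply/existsP; exists \top.
apply/existsP; exists b; apply/existsP; exists \top; rewrite !lex1 /=.
apply/eqP/setP => -[x y]; rewrite !inE /= !lex1 andbT /=.
by have [->|] := eqVneq x \bot; have [->|] := eqVneq y \bot; rewrite ?le0x ?orbT.
Qed.

Definition cobox a b : box A B := Box (in_box_cobox a b).

Lemma in_cobox a b x y : ((x, y) \in box_val (cobox a b)) = (x <= a) || (y <= b).
Proof. by rewrite inE. Qed.

Lemma in_box_pure p q : in_box (pure_tensor p q).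
Proof.
apply/in_box_mixed/existsP; exists p; apply/existsP; exists p.
by apply/existsP; exists q; apply/existsP; exists q; rewrite !lexx setUid eqxx.
Qed.

Definition pure p q : box A B := Box (in_box_pure p q).

Lemma in_pure p q x y : ((x, y) \in box_val (pure p q)) =
  [|| y == \bot, x == \bot | (x <= p) && (y <= q)].
Proof. by rewrite !inE orbA. Qed.

Lemma pure_refl p q : (p, q) \in box_val (pure p q).
Proof. by rewrite in_pure !lexx !orbT. Qed.

(** The mixed tensor given by [a1 <= a2] and [b1 <= b2] is the intersection of the coboxes at
    [(a2, \bot)], [(\bot, b2)] and [(a1, b1)]; a point outside it misses one of them. *)
Lemma mixed_sep (X0 : {set A * B}) x y : mixed_tensor X0 -> (x, y) \notin X0 ->
  exists a b, X0 \subset cobox_set a b /\ (x, y) \notin cobox_set a b.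
Proof.
move=> /existsP[a1 /existsP[a2 /existsP[b1 /existsP[b2 /and3P[a12 b12 /eqP ->]]]]].
rewrite !inE /= !negb_or !negb_and => /andP[/andP[/andP[y0 x0] xy12] /andP[_ xy21]].
have sub a b : (a1 <= a) || (b2 <= b) -> (a2 <= a) || (b1 <= b) ->
    pure_tensor a1 b2 :|: pure_tensor a2 b1 \subset cobox_set a b.
  move=> h1 h2; apply/subsetP => -[x' y']; rewrite !inE /=.
  have [->|_] /= := eqVneq y' \bot; first by rewrite le0x orbT.
  have [->|_] /= := eqVneq x' \bot; first by rewrite le0x.
  by case/orP => /andP[hx hy]; [move: h1|move: h2] => /orP[] h;
     rewrite ?(le_trans hx h) ?(le_trans hy h) ?orbT.
have [xa2|xa2] := boolP (x <= a2); last first.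
  exists a2, \bot; split; first by apply: sub; rewrite ?a12 ?lexx.
  by rewrite inE /= lex0 negb_or xa2.
have [yb2|yb2] := boolP (y <= b2); last first.
  exists \bot, b2; split; first by apply: sub; rewrite ?b12 ?lexx ?orbT.
  by rewrite inE /= lex0 negb_or x0.
exists a1, b1; split; first by apply: sub; rewrite ?lexx ?orbT.
by rewrite inE /= negb_or; move: xy12 xy21; rewrite xa2 yb2 /= orbF => -> ->.
Qed.

Lemma box_sep X x y : (x, y) \notin box_val X ->
  exists a b, [/\ X <= cobox a b, ~~ (x <= a) & ~~ (y <= b)].
Proof.
have /in_boxP[S mS XS] := box_valP X; rewrite XS => /bigcapP XN.
have [X0 SX0 xyX0] : exists2 X0, X0 \in S & (x, y) \notin X0.
  apply: contrapT => H; apply: XN => X0 SX0.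
  by apply: contraT => ?; case: H; exists X0.
have [a [b [X0ab]]] := mixed_sep (mS _ SX0) xyX0.
rewrite inE negb_or /= => /andP[xa yb]; exists a, b; split=> //.
by rewrite box_leE XS; apply: subset_trans X0ab; exact: bigcap_inf.
Qed.

Lemma box_mem X x y :
  (forall a b, X <= cobox a b -> (x <= a) || (y <= b)) -> (x, y) \in box_val X.
Proof.
move=> XH; apply: contraT => /box_sep[a [b [/XH/orP[] xy xa yb]]].
  by rewrite xy in xa.
by rewrite xy in yb.
Qed.

Lemma mem_cobox X a b x y :
  X <= cobox a b -> (x, y) \in box_val X -> (x <= a) || (y <= b).
Proof. by move=> /subsetP XC /XC; rewrite in_cobox. Qed.

Lemma box_down X x x' y y' :
  x' <= x -> y' <= y -> (x, y) \in box_val X -> (x', y') \in box_val X.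
Proof.
move=> xx yy Xxy; apply: box_mem => a b /mem_cobox /(_ Xxy).
by case/orP => h; rewrite ?(le_trans xx h) ?(le_trans yy h) ?orbT.
Qed.

Lemma box_bot X x y : (y == \bot) || (x == \bot) -> (x, y) \in box_val X.
Proof.
by move=> /orP[/eqP->|/eqP->]; apply: box_mem => a b _; rewrite le0x ?orbT.
Qed.

(** For fixed [y], the section of a cobox is a principal ideal or all of [A], and [X] is an
    intersection of coboxes. *)
Lemma box_joinl X x x' y :
  (x, y) \in box_val X -> (x', y) \in box_val X -> (x `|` x', y) \in box_val X.
Proof.
move=> Xx Xx'; apply: box_mem => a b Xab.
have := mem_cobox Xab Xx; have := mem_cobox Xab Xx'; rewrite leUx.
by case: (y <= b); rewrite ?orbT // !orbF => -> ->.
Qed.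

Lemma box_joinr X x y y' :
  (x, y) \in box_val X -> (x, y') \in box_val X -> (x, y `|` y') \in box_val X.
Proof.
move=> Xy Xy'; apply: box_mem => a b Xab.
have := mem_cobox Xab Xy; have := mem_cobox Xab Xy'; rewrite leUx.
by case: (x <= a) => //= -> ->.
Qed.

Lemma pure_le p q X : (pure p q <= X) = ((p, q) \in box_val X).
Proof.
apply/idP/idP => [/subsetP|Xpq]; first by apply; exact: pure_refl.
apply/subsetP => -[x y]; rewrite in_pure orbA.
by case/orP => [|/andP[xp yq]]; [exact: box_bot|exact: box_down Xpq].
Qed.

Lemma cobox_le a a' b b' : a <= a' -> b <= b' -> cobox a b <= cobox a' b'.
Proof.
move=> aa bb; apply/subsetP => -[x y]; rewrite !in_cobox.
by case/orP => h; rewrite ?(le_trans h aa) ?(le_trans h bb) ?orbT.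
Qed.

Lemma box_nle X Y : ~~ (X <= Y) ->
  exists x y, (x, y) \in box_val X /\ (x, y) \notin box_val Y.
Proof. by case/subsetPn => -[x y]; exists x, y. Qed.

(** Maximize the sum of the heights of [a] and [b] over the coboxes that contain [V] but not [W]. *)
Lemma box_sep_max V W : ~~ (W <= V) ->
  exists a b, [/\ V <= cobox a b, ~~ (W <= cobox a b),
    forall a', a < a' -> W <= cobox a' b & forall b', b < b' -> W <= cobox a b'].
Proof.
pose P (c : A * B) := (V <= cobox c.1 c.2) && ~~ (W <= cobox c.1 c.2).
case/box_nle => x [y [Wxy /box_sep[a0 [b0 [Vab xa yb]]]]].
have P0 : P (a0, b0).
  rewrite /P Vab /=; apply/negP => /mem_cobox /(_ Wxy).
  by rewrite (negPf xa) (negPf yb).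
case: (arg_maxnP (fun c => height c.1 + height c.2)%N P0) => -[a b] /andP[/= Vm Wm] max.
exists a, b; split=> // [a' aa'|b' bb']; apply: contraT => WN.
  have /max /= : P (a', b).
    by rewrite /P WN andbT (le_trans Vm) // cobox_le // ltW.
  by rewrite leqNgt ltn_add2r lt_height.
have /max /= : P (a, b').
  by rewrite /P WN andbT (le_trans Vm) // cobox_le // ltW.
by rewrite leqNgt ltn_add2l lt_height.
Qed.

(** Separate the two sides by a maximal cobox at [(a, b)]. Both [Y] and [Z] have a point outside it,
    while the componentwise meet of these points is inside. By maximality, the two first coordinates
    have the same join with [a], and the two second ones the same join with [b], so
    semidistributivity in one factor gives a contradiction. *)
Lemma box_jsd : join_semidistributive A -> join_semidistributive B ->
  join_semidistributive (box A B).
Proof.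
move=> jA jB X Y Z XYZ; apply/le_anti/andP; split; last by rewrite leU2 ?leIl.
apply: contraT => /box_sep_max[a [b [Vm Wm maxa maxb]]].
have Xm : X <= cobox a b by apply: le_trans Vm; exact: leUl.
have [x [y [Yxy xyN]]] : exists x y, (x, y) \in box_val Y /\ (x, y) \notin box_val (cobox a b).
  by apply: box_nle; apply: contra Wm => Ym; rewrite leUx Xm.
have [x' [y' [Zxy xyN']]] : exists x y, (x, y) \in box_val Z /\ (x, y) \notin box_val (cobox a b).
  by apply: box_nle; apply: contra Wm => Zm; rewrite XYZ leUx Xm.
move: xyN xyN'; rewrite !in_cobox !negb_or => /andP[xa yb] /andP[xa' yb'].
have YW : Y <= X `|` Y by exact: leUr.
have ZW : Z <= X `|` Y by rewrite XYZ; exact: leUr.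
have : (x `&` x', y `&` y') \in box_val (X `|` (Y `&` Z)).
  apply: (subsetP (leUr (Y `&` Z) X)); rewrite inE.
  by rewrite (box_down (leIl _ _) (leIl _ _) Yxy) (box_down (leIr _ _) (leIr _ _) Zxy).
have ltU (d : Order.disp_t) (L : latticeType d) (u v : L) : ~~ (v <= u) -> u < u `|` v.
  by move=> vu; rewrite lt_neqAle leUl andbT eq_sym eq_joinl.
move/(mem_cobox Vm) => /orP[xxa|yyb].
  have ax : a `|` x = a `|` x'.
    apply/le_anti; rewrite !leUx !leUl /=; apply/andP; split.
      have := mem_cobox (le_trans YW (maxa _ (ltU _ _ _ _ xa'))) Yxy.
      by rewrite (negPf yb) orbF.
    have := mem_cobox (le_trans ZW (maxa _ (ltU _ _ _ _ xa))) Zxy.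
    by rewrite (negPf yb') orbF.
  by have := jA _ _ _ ax; rewrite (join_idPl xxa) => /join_idPl; rewrite (negPf xa).
have ay : b `|` y = b `|` y'.
  apply/le_anti; rewrite !leUx !leUl /=; apply/andP; split.
    have := mem_cobox (le_trans YW (maxb _ (ltU _ _ _ _ yb'))) Yxy.
    by rewrite (negPf xa).
  have := mem_cobox (le_trans ZW (maxb _ (ltU _ _ _ _ yb))) Zxy.
  by rewrite (negPf xa').
by have := jB _ _ _ ay; rewrite (join_idPl yyb) => /join_idPl; rewrite (negPf yb).
Qed.

(** The cobox at [(a, b)] is maximal among those containing [Y] but not [(s, t)], and [(p, q)] is a
    point of [X] outside it of least height. Minimality bounds [low p] and [low q]; maximality
    bounds [s] and [t]. The result is the input of [low_absorb] in both factors. *)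
Lemma box_dependency X Y s t :
  (s, t) \in box_val (X `|` Y) -> (s, t) \notin box_val Y ->
  exists p q a b,
    [/\ (p, q) \in box_val X, (p, q) \notin box_val Y,
        [/\ low p <= a, ~~ (p <= a), s <= a `|` p & ~~ (s <= a)] &
        [/\ low q <= b, ~~ (q <= b), t <= b `|` q & ~~ (t <= b)]].
Proof.
rewrite -!pure_le => stXY /box_sep_max[a [b [Yab stab maxa maxb]]].
have Xab : ~~ (X <= cobox a b).
  by apply: contra stab => Xab; apply: le_trans stXY _; rewrite leUx Xab.
pose P (c : A * B) := (c \in box_val X) && (c \notin box_val (cobox a b)).
have [x [y [Xxy xyN]]] := box_nle Xab.
have P0 : P (x, y) by rewrite /P Xxy.
case: (arg_minnP (fun c => height c.1 + height c.2)%N P0) => -[p q] /andP[Xpq pqN] min.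
move: (pqN) (stab); rewrite in_cobox pure_le in_cobox !negb_or.
move=> /andP[pa qb] /andP[sa tb].
exists p, q, a, b; split=> //.
- by apply: contra pqN; apply/subsetP.
- split=> //.
    apply/joinsP => z zp; apply: contraT => za.
    have /min /= : P (z, q).
      by rewrite /P (box_down (ltW zp) (lexx _) Xpq) in_cobox negb_or za.
    by rewrite leqNgt ltn_add2r lt_height.
  have /maxa : a < a `|` p by rewrite lt_neqAle leUl andbT eq_sym eq_joinl.
  by rewrite pure_le in_cobox (negPf tb) orbF.
- split=> //.
    apply/joinsP => z zq; apply: contraT => zb.
    have /min /= : P (p, z).
      by rewrite /P (box_down (lexx _) (ltW zq) Xpq) in_cobox negb_or zb andbT.
    by rewrite leqNgt ltn_add2l lt_height.
  have /maxb : b < b `|` q by rewrite lt_neqAle leUl andbT eq_sym eq_joinl.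
  by rewrite pure_le in_cobox (negPf sa).
Qed.

(* As [cobox a b `&` pure a' b'] is the mixed tensor a(x)b' \cup a'(x)b when a <= a'
   and b <= b', this is the image of Delta(a, a') (x) Delta(b, b'). *)
Definition gamma a a' b b' : Dim (box A B) := delta (cobox a b) (pure a' b').

Lemma gamma_xxl a b b' : gamma a a b b' = 0%R.
Proof. by rewrite /gamma delta_le0 // pure_le in_cobox lexx. Qed.

Lemma gamma_xxr a a' b : gamma a a' b b = 0%R.
Proof. by rewrite /gamma delta_le0 // pure_le in_cobox lexx orbT. Qed.

Lemma pure_mono a a' b b' : a <= a' -> b <= b' -> pure a b <= pure a' b'.
Proof. by move=> aa bb; rewrite pure_le in_pure aa bb !orbT. Qed.

(** Split at [pure a' b']: its join with [cobox a b] and the element [cobox a' b] have the same meet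
    with [pure a'' b']. *)
Lemma gamma_transl a a' a'' b b' : a <= a' -> a' <= a'' ->
  gamma a a'' b b' = (gamma a a' b b' + gamma a' a'' b b')%R.
Proof.
move=> aa' aa''; rewrite /gamma (@deltaD _ _ _ (pure a' b')) ?pure_mono //.
congr (_ + _)%R; apply: eq_deltaI; apply/le_anti; rewrite !lexI !leIr !andbT.
apply/andP; split.
  apply: le_trans (leIl _ _) _; rewrite leUx cobox_le //=.
  by rewrite pure_le in_cobox lexx.
apply/subsetP => -[x y]; rewrite inE in_cobox in_pure orbA => /andP[xy].
case/orP => [|/andP[xa yb]]; first exact: box_bot.
case/orP: xy => [xa'|yb'].
  by apply: (subsetP (leUr (pure a' b') _)); rewrite in_pure xa' yb !orbT.
by apply: (subsetP (leUl _ (pure a' b'))); rewrite in_cobox yb' orbT.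
Qed.

Lemma gamma_transr a a' b b' b'' : b <= b' -> b' <= b'' ->
  gamma a a' b b'' = (gamma a a' b b' + gamma a a' b' b'')%R.
Proof.
move=> bb' bb''; rewrite /gamma (@deltaD _ _ _ (pure a' b')) ?pure_mono //.
congr (_ + _)%R; apply: eq_deltaI; apply/le_anti; rewrite !lexI !leIr !andbT.
apply/andP; split.
  apply: le_trans (leIl _ _) _; rewrite leUx cobox_le //=.
  by rewrite pure_le in_cobox lexx orbT.
apply/subsetP => -[x y]; rewrite inE in_cobox in_pure orbA => /andP[xy].
case/orP => [|/andP[xa yb]]; first exact: box_bot.
case/orP: xy => [xa'|yb'].
  by apply: (subsetP (leUl _ (pure a' b'))); rewrite in_cobox xa'.
by apply: (subsetP (leUr (pure a' b') _)); rewrite in_pure xa yb' !orbT.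
Qed.

(** Both sides equal [gamma x' x b b']: on the left by comparing meets with [pure x b'], on the
    right because [cobox x' b] already contains [(x', b')]. *)
Lemma gamma_IUl x x' b b' : gamma (x `&` x') x b b' = gamma x' (x `|` x') b b'.
Proof.
have -> : gamma (x `&` x') x b b' = gamma x' x b b'.
  apply: eq_deltaI; apply/val_inj/setP => -[p q].
  rewrite !inE /= lexI; case: (eqVneq p \bot) => [->|_]; first by rewrite !le0x.
  case: (eqVneq q \bot) => [->|_]; first by rewrite !le0x !orbT.
  by case: (p <= x); rewrite //= !andbF.
rewrite /gamma -[LHS]deltaU -[RHS]deltaU; congr delta; apply/le_anti.
rewrite !leUx !leUl /= (le_trans (pure_mono (leUl x x') (lexx b')) (leUr _ _)) /=.
rewrite pure_le; apply: box_joinl; first by rewrite -pure_le leUr.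
by apply: (subsetP (leUl (cobox x' b) _)); rewrite in_cobox lexx.
Qed.

Lemma gamma_IUr a a' y y' : gamma a a' (y `&` y') y = gamma a a' y' (y `|` y').
Proof.
have -> : gamma a a' (y `&` y') y = gamma a a' y' y.
  apply: eq_deltaI; apply/val_inj/setP => -[p q].
  rewrite !inE /= lexI; case: (eqVneq p \bot) => [->|_]; first by rewrite !le0x.
  case: (eqVneq q \bot) => [->|_]; first by rewrite !le0x !orbT.
  by case: (q <= y); rewrite //= !andbF.
rewrite /gamma -[LHS]deltaU -[RHS]deltaU; congr delta; apply/le_anti.
rewrite !leUx !leUl /= (le_trans (pure_mono (lexx a') (leUl y y')) (leUr _ _)) /=.
rewrite pure_le; apply: box_joinr; first by rewrite -pure_le leUr.
by apply: (subsetP (leUl (cobox a y') _)); rewrite in_cobox lexx orbT.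
Qed.

Lemma box_dense X Y : ~~ (Y <= X) ->
  exists c : A * B, [/\ pure c.1 c.2 <= Y, ~~ (pure c.1 c.2 <= X) &
    cobox (low c.1) (low c.2) `&` pure c.1 c.2 <= X].
Proof.
move=> /box_nle[x [y [Yxy Xxy]]].
pose P (c : A * B) := (c \in box_val Y) && (c \notin box_val X).
have P0 : P (x, y) by rewrite /P Yxy.
case: (arg_minnP (fun c => height c.1 + height c.2)%N P0) => -[p q] /andP[Ypq pqN] min.
exists (p, q); rewrite !pure_le; split=> //=.
(* By minimality [X] contains [(z, q)] for every [z < p], and [X] is closed under joins in each
   coordinate. *)
have lowp : (low p, q) \in box_val X.
  rewrite /low; elim/big_ind: _ => [|z z'|z zp]; [|exact: box_joinl|].
    by apply: box_bot; rewrite eqxx orbT.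
  apply: contraT => zN; have /min /= : P (z, q).
    by rewrite /P zN (box_down (ltW zp) (lexx _) Ypq).
  by rewrite leqNgt ltn_add2r lt_height.
have lowq : (p, low q) \in box_val X.
  rewrite /low; elim/big_ind: _ => [|z z'|z zq]; [|exact: box_joinr|].
    by apply: box_bot; rewrite eqxx.
  apply: contraT => zN; have /min /= : P (p, z).
    by rewrite /P zN (box_down (lexx _) (ltW zq) Ypq).
  by rewrite leqNgt ltn_add2l lt_height.
apply/subsetP => -[u v]; rewrite inE in_cobox in_pure orbA => /andP[uv].
case/orP => [|/andP[up vq]]; first exact: box_bot.
by case/orP: uv => h; [exact: box_down lowp|exact: box_down lowq].
Qed.

(** Since [X] misses [(p, q)], each of its points with nonzero coordinates has one strictly below
    [p] or [q]. *)
Lemma pure_lt_lower p q X : X < pure p q -> X <= cobox (low p) (low q) `&` pure p q.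
Proof.
move=> Xpq; rewrite lexI (ltW Xpq) andbT; apply/subsetP => -[x y] Xxy.
have := subsetP (ltW Xpq) _ Xxy; rewrite in_pure orbA.
case/orP => [|/andP[xp yq]]; first exact: box_bot.
rewrite in_cobox; have [xp'|xNp] := eqVneq x p; last first.
  by rewrite lt_low // lt_neqAle xNp.
have [yq'|yNq] := eqVneq y q; last by rewrite (@lt_low _ _ y) ?orbT // lt_neqAle yNq.
by move: Xxy; rewrite xp' yq' -pure_le lt_geF.
Qed.

(** Distinct pairs give the same pure tensor only when it is the least element, which is the
    degenerate case. *)
Lemma pure_inj_lower p q p' q' : pure p q = pure p' q' ->
  (p, q) = (p', q') \/ cobox (low p) (low q) `&` pure p q = pure p q.
Proof.
move=> e; have [/orP pq0|] := boolP ((p == \bot) || (q == \bot)).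
  right; apply/meet_idPr; rewrite pure_le in_cobox.
  by case: pq0 => /eqP ->; rewrite le0x ?orbT.
rewrite negb_or => /andP[p0 q0]; left.
have := pure_refl p q; rewrite e in_pure (negPf p0) (negPf q0) /= => /andP[pp qq].
have p0' : p' != \bot by apply: contraNneq p0 => p0'; rewrite -lex0 -p0'.
have q0' : q' != \bot by apply: contraNneq q0 => q0'; rewrite -lex0 -q0'.
have := pure_refl p' q'; rewrite -e in_pure (negPf p0') (negPf q0') /= => /andP[pp' qq'].
by congr pair; apply/le_anti/andP.
Qed.

Hypotheses (jA : join_semidistributive A) (jB : join_semidistributive B).

Lemma delta_box_sum X Y : delta X Y =
  (\sum_(c : A * B | (c \in box_val Y) && (c \notin box_val X))
     gamma (low c.1) c.1 (low c.2) c.2)%R.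
Proof.
pose e (c : A * B) := pure c.1 c.2.
pose l (c : A * B) := cobox (low c.1) (low c.2) `&` e c.
rewrite (@delta_sum _ _ _ e l).
- apply: eq_big => [[p q]|[p q] _]; first by rewrite /e !pure_le.
  by apply: eq_deltaI; rewrite -meetA meetxx.
- by move=> c; exact: leIr.
- by move=> [p q] Z; exact: pure_lt_lower.
- exact: box_dense.
- by move=> [p q] [p' q'] /pure_inj_lower.
- exact: box_jsd.
Qed.

End Box.

(** * The two maps between [Dim (box A B)] and the tensor product *)

Section DimensionTensor.
Variables (dA dB : Order.disp_t).
Variables (A : finTBLatticeType dA) (B : finTBLatticeType dB).
Hypotheses (jA : join_semidistributive A) (jB : join_semidistributive B).

Let T := tensor (Dim A) (Dim B).
Let tau (c : A * B) : T := tens (delta (low c.1) c.1) (delta (low c.2) c.2).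

Lemma tau_absorb (X Y : box A B) c : c \in box_val (X `|` Y) ->
  c \notin box_val X -> c \notin box_val Y ->
  exists2 c', (c' \in box_val X) && (c' \notin box_val Y) &
    (tau c + tau c' = tau c')%R.
Proof.
case: c => s t XYst Xst Yst.
have [p [q [a [b [Xpq Ypq [pa pNa sap sNa] [qb qNb tbq tNb]]]]]] := box_dependency XYst Yst.
exists (p, q); first by rewrite Xpq Ypq.
rewrite /tau /=.
have [sp|sp] := eqVneq s p; have [tq|tq] := eqVneq t q.
- by rewrite sp tq Xpq in Xst.
- by rewrite sp -tensDr (low_absorb jB qb qNb tq tbq tNb).
- by rewrite tq -tensDl (low_absorb jA pa pNa sp sap sNa).
(* Expanding D(p) as D(s) + D(p) creates the intermediate term of D(s) and D(q), which absorbs that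
   of D(s) and D(t). *)
- rewrite -{1 2}(low_absorb jA pa pNa sp sap sNa) tensDl addrA -tensDr.
  by rewrite (low_absorb jB qb qNb tq tbq tNb).
Qed.

Lemma Dim_box_to_tensor : exists f : {additive Dim (box A B) -> T},
  forall X Y, f (delta X Y) =
    (\sum_(c | (c \in box_val Y) && (c \notin box_val X)) tau c)%R.
Proof.
pose h (i : Defs.interval (box A B)) : T :=
  (\sum_(c | (c \in box_val (val i).2) && (c \notin box_val (val i).1)) tau c)%R.
have [|f fE] := @cm_lift _ (@dim_rel _ (box A B)) T h.
  move=> s t [X|X Y Z XY YZ|X Y]; rewrite ?big_cons ?big_nil ?addr0 /h /=.
  - by rewrite big1 // => c; rewrite andbN.
  - rewrite (bigID (mem (box_val Y))) /=; congr (_ + _)%R; apply: eq_bigl => c.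
      have /implyP := subsetP YZ c.
      by case: (c \in box_val X); case: (c \in box_val Y); case: (c \in box_val Z).
    have /implyP := subsetP XY c.
    by case: (c \in box_val X); case: (c \in box_val Y); case: (c \in box_val Z).
  (* The pairs of the join outside [Y] are those of [X] outside [Y], which match the left side, and
     those in neither, which are absorbed. *)
  - rewrite [RHS](bigID (mem (box_val X))) /= addrC.
    pose P c := (c \in box_val X) && (c \notin box_val Y).
    rewrite [LHS](eq_bigl P) => [|c]; last by rewrite inE /P; case: (c \in box_val X).
    rewrite [X in (_ + X)%R](eq_bigl P) => [|c].
      symmetry; apply: sum_absorb => c /andP[/andP[XYc Yc] Xc].
      exact: tau_absorb.
    rewrite /P andbC; have [Xc|//] := boolP (c \in box_val X).
    by rewrite (subsetP (leUl X Y) _ Xc).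
exists f => X Y; rewrite /delta fE /h /=.
by apply: eq_bigl => c; rewrite inE; case: (c \in box_val Y); rewrite ?andbT.
Qed.

Lemma tensor_to_Dim_box : exists g : {additive T -> Dim (box A B)},
  forall a a' b b', a <= a' -> b <= b' ->
    g (tens (delta a a') (delta b b')) = gamma a a' b b'.
Proof.
pose c (i : Defs.interval A) (j : Defs.interval B) := gamma (val i).1 (val i).2 (val j).1 (val j).2.
have [||g gE] := @cm_bilift _ _ (@dim_rel _ A) (@dim_rel _ B) (Dim (box A B)) c.
- move=> s t h [x|x y z xy yz|x y]; rewrite ?big_cons ?big_nil ?addr0 /c /=.
  + exact: gamma_xxl.
  + exact: gamma_transl.
  + exact: gamma_IUl.
- move=> s t h [x|x y z xy yz|x y]; rewrite ?big_cons ?big_nil ?addr0 /c /=.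
  + exact: gamma_xxr.
  + exact: gamma_transr.
  + exact: gamma_IUr.
by exists g => a a' b b' aa' bb'; rewrite -(DeltaE aa') -(DeltaE bb') gE.
Qed.

End DimensionTensor.

Theorem theorem3 (dA dB : Order.disp_t)
    (A : finTBLatticeType dA) (B : finTBLatticeType dB)
    (hA : join_semidistributive A) (hB : join_semidistributive B) :
  join_semidistributive (box A B) /\
  exists f : {additive Dim (box A B) -> tensor (Dim A) (Dim B)}, bijective f.
Proof.
split; first exact: box_jsd.
have [f fE] := Dim_box_to_tensor hA hB.
have [g gE] := @tensor_to_Dim_box _ _ A B.
exists f; exists g => u.
  elim/cm_ind: u => [|u v IHu IHv|[[X Y] /= XY]]; first by rewrite !raddf0.
    by rewrite !raddfD /= IHu IHv.
  rewrite -[cm_gen _ _]/(Delta XY) DeltaE fE raddf_sum (delta_box_sum hA hB).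
  by apply: eq_bigr => c _; rewrite gE // low_le.
elim/cm_ind: u => [|u v IHu IHv|[u v]]; first by rewrite !raddf0.
  by rewrite !raddfD /= IHu IHv.
rewrite -[cm_gen _ _]/(tens u v).
elim/cm_ind: u => [|u u' IHu IHu'|[[a a'] /= aa']].
- by rewrite tens0l !raddf0.
- by rewrite tensDl !raddfD /= IHu IHu'.
elim/cm_ind: v => [|v v' IHv IHv'|[[b b'] /= bb']].
- by rewrite tens0r !raddf0.
- by rewrite tensDr !raddfD /= IHv IHv'.
rewrite -![cm_gen _ _]/(Delta _) !DeltaE gE // fE.
rewrite (delta_low_sum hA) (delta_low_sum hB) tens_sum.
apply: eq_big => [[p q]|//]; rewrite in_pure in_cobox negb_or /=.
(* Every pure tensor contains the pairs with a zero coordinate, but so does [cobox a b]; the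
   remaining index set is a product. *)
have [->|p0] := eqVneq p \bot; first by rewrite !le0x /= !andbF.
have [->|q0] := eqVneq q \bot; first by rewrite !le0x /= !andbF.
by rewrite andbACA.
Qed.
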